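(* Let $A$ be an integral domain and let $\Delta$ be a nonempty compact subspace of $\mathrm{SStar}_f(A)$ (with the Zariski topology). Then the semistar operation $\bigwedge(\Delta)$ is of finite type.
   Context: Let $A$ be an integral domain with quotient field $K$. $\overline{\mathbf F}(A)$ is the set of all nonzero $A$-submodules of $K$, and $\mathbf f(A)$ is the set of all nonzero finitely generated fractional ideals of $A$ (nonzero finitely generated $A$-submodules of $K$). A semistar operation on $A$ is a map $\star:\overline{\mathbf F}(A)\to\overline{\mathbf F}(A)$, $F\mapsto F^\star$, such that for all nonzero $k\in K$ and all $F,G\in\overline{\mathbf F}(A)$: $(kF)^\star=kF^\star$; $F\subseteq G$ implies $F^\star\subseteq G^\star$; $F\subseteq F^\star$; $(F^\star)^\star=F^\star$. $\mathrm{SStar}(A)$ is the set of all semistar operations on $A$. The Zariski topology on $\mathrm{SStar}(A)$ is the topology having as a subbasis of open sets the sets $V_F:=\{\star\in\mathrm{SStar}(A):1\in F^\star\}$, for $F\in\overline{\mathbf F}(A)$. A semistar operation $\star$ is of finite type if $F^\star=\bigcup\{G^\star:G\in\mathbf f(A),\,G\subseteq F\}$ for every $F\in\overline{\mathbf F}(A)$. $\mathrm{SStar}_f(A)$ is the set of semistar operations of finite type on $A$, and its Zariski topology is the subspace topology from $\mathrm{SStar}(A)$. For a nonempty set $\mathcal S$ of semistar operations on $A$, $\bigwedge(\mathcal S)$ is the semistar operation defined by $F^{\bigwedge(\mathcal S)}:=\bigcap\{F^\star:\star\in\mathcal S\}$ for $F\in\overline{\mathbf F}(A)$. ''Compact''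 means that every open cover has a finite subcover (no separation axiom). *)

(* Defs.v *)
From HB Require Import structures.
From mathcomp Require Import all_boot all_algebra.
From mathcomp Require Import all_classical.
From mathcomp Require Import topology.

Set Implicit Arguments.
Unset Strict Implicit.
Unset Printing Implicit Defensive.

Import GRing.Theory.

Local Open Scope classical_set_scope.
Local Open Scope ring_scope.

(* The quotient field K of A is [{fraction A}], on which A acts through the
   embedding [tofrac : A -> {fraction A}]. *)

Section Semistar.
Variable A : idomainType.
Local Notation K := {fraction A}.

Record Fbar := MkFbar {
  fbar_set :> set K;
  fbar0 : fbar_set 0;
  fbarD : forall x y, fbar_set x -> fbar_set y -> fbar_set (x + y);
  fbarZ : forall (a : A) x, fbar_set x -> fbar_set (tofrac a * x);
  fbar_neq0 : exists2 x, fbar_set x & x != 0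
}.

Lemma fbar_eqP (F G : Fbar) : fbar_set F = fbar_set G -> F = G.
Proof.
case: F G => [F F0 FD FZ Fn] [G G0 GD GZ Gn] /= eFG; subst G.
by congr MkFbar; exact: Prop_irrelevance.
Qed.

Definition fbarT : Fbar.
Proof.
by apply: (@MkFbar [set: K]) => //; exists 1; rewrite ?oner_neq0.
Defined.

HB.instance Definition _ := gen_eqMixin Fbar.
HB.instance Definition _ := gen_choiceMixin Fbar.
HB.instance Definition _ := isPointed.Build Fbar fbarT.

Definition fbar_scale (k : K) (k0 : k != 0) (F : Fbar) : Fbar.
Proof.
apply: (@MkFbar [set k * x | x in fbar_set F]).
- by exists 0; [exact: fbar0 | rewrite mulr0].
- move=> _ _ [x Fx <-] [y Fy <-]; exists (x + y); last by rewrite mulrDr.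
  exact: fbarD.
- move=> a _ [x Fx <-]; exists (tofrac a * x); last by rewrite mulrCA.
  exact: fbarZ.
- have [x Fx x0] := fbar_neq0 F.
  by exists (k * x); [exists x | rewrite mulf_neq0].
Defined.

(* F is in f(A) iff it is the A-span of finitely many elements of K. *)
Definition fbar_fg (F : Fbar) : Prop :=
  exists (n : nat) (g : 'I_n -> K),
    fbar_set F = [set \sum_(i < n) tofrac (a i) * g i | a in [set: 'I_n -> A]].

Record SStar := MkSStar {
  star :> Fbar -> Fbar;
  star_scale : forall (k : K) (k0 : k != 0) (F : Fbar),
    star (fbar_scale k0 F) = fbar_scale k0 (star F);
  star_mono : forall F G : Fbar, fbar_set F `<=` fbar_set G ->
    fbar_set (star F) `<=` fbar_set (star G);
  star_ext : forall F : Fbar, fbar_set F `<=` fbar_set (star F);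
  star_idem : forall F : Fbar, star (star F) = star F
}.

HB.instance Definition _ := gen_eqMixin SStar.
HB.instance Definition _ := gen_choiceMixin SStar.

Definition zariskiV (F : Fbar) : set SStar := [set s | fbar_set (s F) 1].

HB.instance Definition _ :=
  isSubBaseTopological.Build SStar [set: Fbar] zariskiV.

Definition finite_type (s : SStar) : Prop :=
  forall F : Fbar, fbar_set (s F) =
    \bigcup_(G in [set G | fbar_fg G /\ fbar_set G `<=` fbar_set F])
      fbar_set (s G).

(* Used as a type, [SStarf] is coerced to the subtype [set_type SStarf], whose
   canonical topology is the one induced from [SStar]. *)
Definition SStarf : set SStar := [set s | finite_type s].

Definition bigwedge_set (S : set SStar) (F : Fbar) : set K :=
  \bigcap_(s in S) fbar_set (s F).

Lemma bigwedge_set_ext S F : fbar_set F `<=` bigwedge_set S F.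
Proof. by move=> x Fx s _; exact: star_ext. Qed.

Definition bigwedge_fbar (S : set SStar) (F : Fbar) : Fbar.
Proof.
apply: (@MkFbar (bigwedge_set S F)).
- by move=> s _; exact: fbar0.
- by move=> x y Hx Hy s Ss; apply: fbarD; [exact: Hx | exact: Hy].
- by move=> a x Hx s Ss; apply: fbarZ; exact: Hx.
- have [x Fx x0] := fbar_neq0 F.
  by exists x => //; exact: bigwedge_set_ext.
Defined.

(* Total in S: for empty S this is the constant map to K, the empty
   intersection of subsets of K. *)
Definition bigwedge (S : set SStar) : SStar.
Proof.
apply: (@MkSStar (bigwedge_fbar S)).
- move=> k k0 F; apply: fbar_eqP; apply/seteqP; split => x /=.
  + move=> Hx; exists (k^-1 * x); last by rewrite mulVKf.
    move=> s Ss; have := Hx s Ss; rewrite star_scale => -[y Fy <-].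
    by rewrite mulKf.
  + move=> [y Hy <-] s Ss; rewrite star_scale.
    by exists y => //; exact: Hy.
- by move=> F G FG x Hx s Ss; apply: star_mono FG _ (Hx s Ss).
- by move=> F; exact: bigwedge_set_ext.
- move=> F; apply: fbar_eqP; apply/seteqP; split; last first.
    exact: bigwedge_set_ext.
  move=> x Hx s Ss; rewrite -star_idem; apply: star_mono (Hx s Ss).
  by move=> y; apply.
Defined.

End Semistar.

Arguments SStarf : clear implicits.

(* Main.v *)
Require Import Defs.
From mathcomp Require Import all_boot all_algebra.
From mathcomp Require Import all_classical.
From mathcomp Require Import topology.

(** Why the theorem holds.  Let [x] lie in [F^s] for every [s] in [Delta].
    Each such [s] is of finite type, so it already has [x] in [G^s] for some
    finitely generated [G] contained in [F]; which [G] works depends on [s].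
    Compactness makes the choice uniform.  For [x != 0], homogeneity turns
    [x \in G^s] into [1 \in (x^-1 G)^s] ([star_memE]), so the operations served
    by a given [G] form a subbasic open set, and the finitely generated [G]
    inside [F] give an open cover of [Delta].  Finitely many of them suffice,
    and they are all contained in a single finitely generated module inside
    [F] ([fg_directed_seq]); by monotonicity that one works for every [s] in
    [Delta].  The zero element has to be treated apart, since it cannot be
    scaled to [1]; it lies in every module. *)

Local Open Scope classical_set_scope.
Local Open Scope ring_scope.
Import GRing.Theory.

Section FinitelyGeneratedModules.
Variable A : idomainType.
Local Notation K := {fraction A}.
Implicit Types (F G H : Fbar A) (x : K).

Definition fbar_line {x} (x0 : x != 0) : Fbar A.
Proof.
apply: (@MkFbar A [set tofrac a * x | a in [set: A]]).
- by exists 0; rewrite // tofrac0 mul0r.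
- by move=> _ _ [a _ <-] [b _ <-]; exists (a + b); rewrite // tofracD mulrDl.
- by move=> c _ [a _ <-]; exists (c * a); rewrite // tofracM mulrA.
- by exists x => //; exists 1; rewrite // tofrac1 mul1r.
Defined.

Lemma fbar_line_fg x (x0 : x != 0) : fbar_fg (fbar_line x0).
Proof.
exists 1%N, (fun=> x); apply/seteqP; split=> [_ [a _ <-]|_ [a _ <-]].
  by exists (fun=> a); rewrite // big_ord1.
by exists (a ord0); rewrite // big_ord1.
Qed.

Lemma fg_below F : exists2 G, fbar_fg G & fbar_set G `<=` fbar_set F.
Proof.
have [x Fx x0] := fbar_neq0 F.
exists (fbar_line x0); first exact: fbar_line_fg.
by move=> _ [a _ <-]; apply: fbarZ.
Qed.

Definition fbar_add F G : Fbar A.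
Proof.
apply: (@MkFbar A [set x + y | x in fbar_set F & y in fbar_set G]).
- by exists 0; [exact: fbar0|exists 0; [exact: fbar0|rewrite addr0]].
- move=> _ _ [x Fx [y Gy <-]] [x' Fx' [y' Gy' <-]].
  exists (x + x'); first exact: fbarD.
  by exists (y + y'); [exact: fbarD|rewrite addrACA].
- move=> a _ [x Fx [y Gy <-]]; exists (tofrac a * x); first exact: fbarZ.
  by exists (tofrac a * y); [exact: fbarZ|rewrite mulrDr].
- have [x Fx x0] := fbar_neq0 F; exists x => //.
  by exists x => //; exists 0; [exact: fbar0|rewrite addr0].
Defined.

Lemma fbar_addl F G : fbar_set F `<=` fbar_set (fbar_add F G).
Proof. by move=> x Fx; exists x => //; exists 0; [exact: fbar0|rewrite addr0]. Qed.

Lemma fbar_addr F G : fbar_set G `<=` fbar_set (fbar_add F G).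
Proof. by move=> x Gx; exists 0; [exact: fbar0|exists x; rewrite // add0r]. Qed.

Lemma fbar_add_sub F G H : fbar_set F `<=` fbar_set H ->
  fbar_set G `<=` fbar_set H -> fbar_set (fbar_add F G) `<=` fbar_set H.
Proof. by move=> FH GH _ [x /FH Hx [y /GH Hy <-]]; apply: fbarD. Qed.

(** Concatenating the two generating families generates the sum. *)
Lemma fbar_add_fg F G : fbar_fg F -> fbar_fg G -> fbar_fg (fbar_add F G).
Proof.
move=> [n [f Ff]] [m [g Gg]].
pose cat T (u : 'I_n -> T) (v : 'I_m -> T) (i : 'I_(n + m)) :=
  match fintype.split i with inl j => u j | inr j => v j end.
have catl T u v j : cat T u v (lshift m j) = u j.
  by rewrite /cat (unsplitK (inl j)).
have catr T u v j : cat T u v (rshift n j) = v j.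
  by rewrite /cat (unsplitK (inr j)).
exists (n + m)%N, (cat _ f g); rewrite /= Ff Gg; apply/seteqP; split=> z.
  move=> [_ [a _ <-] [_ [b _ <-] <-]]; exists (cat _ a b) => //.
  by rewrite big_split_ord; congr (_ + _); apply: eq_bigr => j _;
    rewrite ?catl ?catr.
move=> [c _ <-].
exists (\sum_(i < n) tofrac (c (lshift m i)) * f i).
  by exists (fun i => c (lshift m i)).
exists (\sum_(i < m) tofrac (c (rshift n i)) * g i).
  by exists (fun i => c (rshift n i)).
by rewrite big_split_ord; congr (_ + _); apply: eq_bigr => j _;
  rewrite ?catl ?catr.
Qed.

Lemma fg_directed_seq F (s : seq (Fbar A)) :
    (forall G, G \in s -> fbar_fg G /\ fbar_set G `<=` fbar_set F) ->
  exists H, [/\ fbar_fg H, fbar_set H `<=` fbar_set F &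
    forall G, G \in s -> fbar_set G `<=` fbar_set H].
Proof.
elim: s => [|G s IHs] sF; first by have [H fgH HF] := fg_below F; exists H.
have [G' G's|H [fgH HF sH]] := IHs; first by apply: sF; rewrite inE G's orbT.
have [fgG GF] := sF G (mem_head _ _).
exists (fbar_add G H); split; [exact: fbar_add_fg|exact: fbar_add_sub|].
move=> G'; rewrite inE => /predU1P[->|/sH G'H]; first exact: fbar_addl.
exact: subset_trans G'H (@fbar_addr G H).
Qed.

End FinitelyGeneratedModules.

Section Zariski.
Variable A : idomainType.
Local Notation K := {fraction A}.

Lemma zariskiV_open (F : Fbar A) : open (zariskiV F).
Proof.
exists [set zariskiV F]; last by rewrite bigcup_set1.
by move=> _ ->; exact: finI_from1.
Qed.

(** Homogeneity lets membership of any nonzero [x], and not only of [1], be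
    read off a subbasic open set. *)
Lemma star_memE (s : SStar A) (F : Fbar A) (x : K) (x0 : x^-1 != 0) :
  fbar_set (s F) x <-> zariskiV (fbar_scale x0 F) s.
Proof.
have xn0 : x != 0 by rewrite -invr_eq0.
rewrite /zariskiV /= star_scale; split=> [sFx|[y sFy xy1]].
  by exists x; rewrite // mulVf.
by rewrite -[x]mulr1 -xy1 mulVKf.
Qed.

End Zariski.

Theorem proposition2p7 (A : idomainType) (Delta : set (SStarf A))
    (Delta_neq0 : Delta !=set0) (Delta_compact : cover_compact Delta) :
  finite_type (bigwedge (set_val @` Delta)).
Proof.
move=> F; apply/seteqP; split=> [x Fx|x [G [_ GF]]]; last exact: star_mono.
have [->|x0] := eqVneq x 0.
  by have [G fgG GF] := fg_below _ F; exists G => //; exact: fbar0.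
have xV0 : x^-1 != 0 by rewrite invr_eq0.
pose D := [set G : Fbar A | fbar_fg G /\ fbar_set G `<=` fbar_set F].
pose U (G : Fbar A) : set (SStarf A) :=
  set_val @^-1` zariskiV (fbar_scale xV0 G).
have U_open G : D G -> open (U G).
  move=> _; exists (zariskiV (fbar_scale xV0 G)) => //.
  exact: zariskiV_open.
have U_cover : Delta `<=` cover D U.
  move=> s Ds; have : fbar_set (set_val s F) x by apply: Fx; exists s.
  have s_ft : finite_type (set_val s) := set_valP s.
  rewrite s_ft => -[G DG sGx].
  by exists G => //; apply: (star_memE _ _ _ _ xV0).1.
have [D' D'D D'_cover] := Delta_compact _ _ _ U_open U_cover.
have [|H [fgH HF D'H]] := @fg_directed_seq A F (finmap.enum_fset D').
  by move=> G /D'D; rewrite inE.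
exists H => //= _ [s Ds <-].
have [G D'G] := D'_cover s Ds.
move=> /(star_memE _ _ _ _ xV0).2; apply: star_mono; exact: D'H.
Qed.
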